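(* Let $v>k\geq 2$ be integers, let $r:=\frac{v-1}{k-1}$, and let $\mathbb{F}$ be $\mathbb{R}$ or $\mathbb{C}$. (1) If $\Phi$ is a matrix over $\mathbb{F}$ whose columns form an equiangular tight frame (ETF) for their span and $|\Phi|^2$ is the $b\times v$ incidence matrix of a $\mathrm{BIBD}(v,k,1)$, then the rank of $\Phi$ is necessarily $$d=\frac{vr}{r+k-1},$$ and the redundancy $\frac vd$ of this ETF is less than $2$. (2) If $\Phi$ is a matrix over $\mathbb{F}$ such that $|\Phi|^2$ is the $b\times v$ incidence matrix of a $\mathrm{BIBD}(v,k,1)$, then the columns of $\Phi$ form an ETF for their span if and only if $$\sum_{i'=1}^{b}\sum_{j'=1}^{v}\Phi(i,j')\,\overline{\Phi(i',j')}\,\Phi(i',j)=0\quad\text{for all } i \text{ and } j \text{ such that } \Phi(i,j)=0.$$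
   Context: Inner products on $\mathbb{F}^m$ are standard dot products, conjugate-linear in the first argument. Vectors $\varphi_1,\dots,\varphi_n\in\mathbb{F}^m$ form an equiangular tight frame (ETF) for their span $H$ if they are nonzero with equal norms, there is a constant $w$ with $|\langle\varphi_i,\varphi_j\rangle|=w$ for all $i\neq j$, and there is $a>0$ with $\sum_{i=1}^n\langle\varphi_i,x\rangle\varphi_i=ax$ for all $x\in H$. For integers $v>k\geq 2$, a $\mathrm{BIBD}(v,k,1)$ is a $v$-element vertex set together with a collection of subsets, called blocks, such that every block contains exactly $k$ vertices and every pair of distinct vertices is contained in exactly one block. Letting $b$ be the number of blocks, its incidence matrix is the $b\times v$ $\{0,1\}$-matrix whose rows are indexed by blocks and columns by vertices, with $(i,j)$ entry $1$ iff the $j$th vertex lies in the $i$th block. $|\Phi|^2$ denotes the entrywise squared modulus of $\Phi$: its $(i,j)$ entry is $|\Phi(i,j)|^2$. *)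

(* Defs.v *)
From HB Require Import structures.
From mathcomp Require Import all_boot all_order all_algebra.
From mathcomp Require Import complex.
From mathcomp Require Import reals.

Set Implicit Arguments.
Unset Strict Implicit.
Unset Printing Implicit Defensive.

Import Order.TTheory GRing.Theory Num.Theory.
Local Open Scope ring_scope.

Inductive scalars := RealScalars | ComplexScalars.

Definition scalar_field (R : realType) (K : scalars) : numFieldType :=
  match K with
  | RealScalars => R
  | ComplexScalars => R[i]
  end.

Definition sconj (R : realType) (K : scalars) :
    scalar_field R K -> scalar_field R K :=
  match K with
  | RealScalars => fun x : R => x
  | ComplexScalars => fun z : R[i] => z^*
  end.

(* On nonnegative arguments, both branches give the nonnegative square root. *)
Definition ssqrt (R : realType) (K : scalars) :
    scalar_field R K -> scalar_field R K :=
  match K with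
  | RealScalars => fun x : R => Num.sqrt x
  | ComplexScalars => fun z : R[i] => sqrtC z
  end.

Section Frames.
Variables (R : realType) (K : scalars).
Local Notation F := (scalar_field R K).

Definition dotp (m : nat) (x y : 'cV[F]_m) : F :=
  \sum_(i < m) sconj (x i 0) * y i 0.

Definition vnorm (m : nat) (x : 'cV[F]_m) : F := ssqrt (dotp x x).

(* Over the complex numbers, [0 < a] in the partial order of [R[i]] says that
   [a] is a positive real. *)
Definition is_ETF (m n : nat) (phi : 'I_n -> 'cV[F]_m) : Prop :=
  [/\ forall i, phi i != 0,
      forall i j, vnorm (phi i) = vnorm (phi j),
      exists w : F, forall i j, i != j -> `|dotp (phi i) (phi j)| = w
    & exists2 a : F, 0 < a &
        forall x, x \in <<[seq phi i | i : 'I_n]>>%VS ->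
          \sum_(i < n) dotp (phi i) x *: phi i = a *: x].

Definition sqr_modulus (m n : nat) (A : 'M[F]_(m, n)) : 'M[F]_(m, n) :=
  map_mx (fun z => `|z| ^+ 2) A.

End Frames.

Definition is_BIBD (T : finType) (v k : nat) (B : {set {set T}}) : Prop :=
  [/\ #|T| = v,
      forall D, D \in B -> #|D| = k
    & forall x y : T, x != y ->
        exists! D : {set T}, D \in B /\ (x \in D /\ y \in D)].

(* [vtx] and [blk] are the orderings of the vertices and of the blocks that
   label the columns and the rows; they force [b = #|B|] and [v = #|T|]. *)
Definition is_incidence_mx (F : nzRingType) (T : finType) (B : {set {set T}})
    (b v : nat) (A : 'M[F]_(b, v)) : Prop :=
  exists (blk : 'I_b -> {set T}) (vtx : 'I_v -> T),
    [/\ injective blk,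
        [set blk i | i : 'I_b] = B,
        bijective vtx
      & forall i j, A i j = (vtx j \in blk i)%:R].

Definition is_BIBD_incidence_mx (F : nzRingType) (k b v : nat)
    (A : 'M[F]_(b, v)) : Prop :=
  exists (T : finType) (B : {set {set T}}),
    is_BIBD v k B /\ is_incidence_mx B A.

(* Main.v *)
(** Two blocks of a BIBD(v,k,1) share at most one vertex, so distinct columns of
    [Phi] always have an inner product of modulus 1, and
    [Phi Phi^* Phi = (r + k - 1) Phi] holds entrywise on the support of [Phi].
    Hence the columns form an ETF iff that identity also holds off the support,
    where its right-hand side vanishes. In that case
    [Phi Phi^* / (r + k - 1)] is an idempotent with the same rank as [Phi], and
    that rank is its trace [v r / (r + k - 1)]. The redundancy is
    [1 + (k - 1) / r], which is less than 2 because [k <= r]. *)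
Require Import Defs.
From mathcomp Require Import all_boot all_order all_algebra.
From mathcomp Require Import complex.
From mathcomp Require Import reals.
From mathcomp Require Import ring lra.

Set Implicit Arguments.
Unset Strict Implicit.
Unset Printing Implicit Defensive.

Import Order.TTheory GRing.Theory Num.Theory.
Local Open Scope ring_scope.

(** In a full-rank factorization [E = C *m R], cancelling [C] on the left and [R] on the right of
    [E *m E = E] leaves [R *m C = 1], of size [\rank E]; the trace is cyclic. *)
Lemma mxrank_idempotent (F : fieldType) (n : nat) (E : 'M[F]_n) :
  E *m E = E -> \tr E = (\rank E)%:R.
Proof.
move=> EE; have := mulmx_base E.
move: (col_base E) (row_base E) (col_base_full E) (row_base_free E).
move=> C R Cfull Rfree CR; have RC1 : R *m C = 1%:M.
  apply: (row_free_inj Rfree); apply: (row_full_inj Cfull).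
  by rewrite /= mul1mx !mulmxA CR -mulmxA CR.
by rewrite -{1}CR mxtrace_mulC RC1 mxtrace1.
Qed.

(** * Counting in finite linear spaces *)

(* Columns are points and rows are lines, i.e. vertices and blocks of a design. *)
Definition linear_space (k b v : nat) (inc : 'I_b -> 'I_v -> bool) : Prop :=
  [/\ forall i, #|[set j | inc i j]| = k,
      forall j j', j != j' -> exists i, inc i j && inc i j'
    & forall j j' i i', j != j' -> inc i j -> inc i j' -> inc i' j ->
        inc i' j' -> i = i'].

(** Injectivity of [blk] turns uniqueness of a block into uniqueness of its row index; bijectivity
    of [vtx] preserves block sizes. *)
Lemma BIBD_incidence_linear_space (F : nzRingType) (k b v : nat)
    (A : 'M[F]_(b, v)) :
  is_BIBD_incidence_mx k A ->
  exists2 inc : 'I_b -> 'I_v -> bool,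
    linear_space k inc & forall i j, A i j = (inc i j)%:R.
Proof.
case=> T [B [[_ Bk B1] [blk [vtx [blkI blkB vtxB AE]]]]].
have blkP i : blk i \in B by rewrite -blkB imset_f.
exists (fun i j => vtx j \in blk i) => //; split=> [i|j j' jj'|j j' i i' jj' ij ij' i'j i'j'].
- rewrite -[RHS](Bk _ (blkP i)) -(on_card_preimset (onW_bij _ vtxB)).
  by apply: eq_card => j; rewrite !inE.
- have /B1[D [[DB /andP Dj] _]] : vtx j != vtx j' by rewrite (inj_eq (bij_inj vtxB)).
  by move: DB; rewrite -blkB => /imsetP[i _ Di]; exists i; rewrite -Di.
- have /B1[D [_ Du]] : vtx j != vtx j' by rewrite (inj_eq (bij_inj vtxB)).
  by apply: blkI; rewrite -(Du (blk i)) // -(Du (blk i')).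
Qed.

Section LinearSpace.
Variables (k b v : nat) (inc : 'I_b -> 'I_v -> bool).
Hypotheses (incP : linear_space k inc) (k_ge2 : (2 <= k)%N) (ltkv : (k < v)%N).

(** Double counting of the pairs of a point other than [j] and a line joining it to [j]. *)
Lemma replicationE (j : 'I_v) : (#|[set i | inc i j]| * k.-1 = v.-1)%N.
Proof.
case: incP => inck ex_inc inc_uniq.
have -> : v.-1 = (\sum_(j' | j' != j) \sum_(i | inc i j) inc i j')%N.
  rewrite (eq_bigr (fun=> 1%N)) => [|j' j'j].
    by rewrite sum1_card cardC1 card_ord.
  rewrite eq_sym in j'j; have [i0 /andP[i0j i0j']] := ex_inc _ _ j'j.
  rewrite (bigD1 i0) //= i0j' big1 ?addn0 // => i /andP[ij /eqP neq].
  by case: (boolP (inc i j')) => // ij'; case: neq; apply: (inc_uniq j j').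
rewrite exchange_big -sum1_card big_distrl /=.
under eq_bigl do rewrite inE.
apply: eq_bigr => i ij; rewrite mul1n -(inck i) (cardsD1 j) inE ij /=.
rewrite -sum1_card big_mkcond [RHS]big_mkcond /=; apply: eq_bigr => j' _.
by rewrite !inE; case: eqP; case: inc.
Qed.

(* The lines joining a point [x] to the points of a line that misses [x] are
   distinct. *)
Lemma leq_line_replication (j : 'I_v) : (k <= #|[set i | inc i j]|)%N.
Proof.
case: incP => inck ex_inc inc_uniq.
have v_gt1 : (1 < v)%N by apply: leq_trans k_ge2 (ltnW ltkv).
have [i0 _] := ex_inc (Ordinal (ltnW v_gt1)) (Ordinal v_gt1) isT.
have [x xi0] : exists x, ~~ inc i0 x.
  apply/existsP; rewrite -negb_forall; apply: contraTN ltkv => /forallP all_i0.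
  rewrite -(inck i0) -leqNgt -{1}(card_ord v) -cardsT subset_leq_card //.
  by apply/subsetP => y _; rewrite inE all_i0.
(* By [replicationE] and [k.-1 > 0], all points lie on equally many lines, so [j] may be replaced by
   a point [x] off [i0]. *)
have -> : #|[set i | inc i j]| = #|[set i | inc i x]|.
  apply/eqP; rewrite -(@eqn_pmul2r k.-1) ?replicationE //.
  by rewrite -ltnS prednK // ltnW.
(* The line joining [x] to [y]; the default is never reached for [y] on [i0], since then
   [x != y]. *)
pose f y := odflt i0 [pick i | inc i x && inc i y].
have fP y : inc i0 y -> inc (f y) x && inc (f y) y.
  move=> i0y; rewrite /f; case: pickP => //= none.
  have xy : x != y by apply: contraNneq xi0 => ->.
  by case: (ex_inc _ _ xy) => i; rewrite none.
rewrite -(inck i0) -(card_in_imset (f := f)) => [|y y']; last first.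
  (* A common value of [f] at two points of [i0] would be [i0] itself, which misses [x]. *)
  rewrite !inE => i0y i0y' fyy'; apply: contraNeq xi0 => yy'.
  have [/andP[fx fy] /andP[_ fy']] := (fP _ i0y, fP _ i0y').
  by rewrite -fyy' in fy'; rewrite -(inc_uniq _ _ _ _ yy' fy fy' i0y i0y').
apply/subset_leq_card/subsetP => _ /imsetP[y + ->].
by rewrite !inE => /fP/andP[].
Qed.

End LinearSpace.

(** * Tight frames over the real or complex scalars *)

Section Scalars.
Variables (R : realType) (K : scalars).
Local Notation F := (scalar_field R K).

Lemma sconj0 : sconj (0 : F) = 0.
Proof. by case: K => //=; rewrite conjC0. Qed.

Lemma sconj_mul (x : F) : sconj x * x = `|x| ^+ 2.
Proof.
case: K x => x /=; first by rewrite -expr2 real_normK ?num_real.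
by rewrite normCKC.
Qed.

Lemma norm_sconj (x : F) : `|sconj x| = `|x|.
Proof. by case: K x => x //=; rewrite norm_conjC. Qed.

Lemma dotpZ (m : nat) (c : F) (x y : 'cV[F]_m) : dotp x (c *: y) = c * dotp x y.
Proof. by rewrite mulr_sumr; apply: eq_bigr => i _; rewrite mxE mulrCA. Qed.

(** The frame operator is linear, so testing it on the spanning vectors suffices. *)
Lemma tight_on_span (m n : nat) (phi : 'I_n -> 'cV[F]_m) (a : F) :
  (forall x, x \in <<[seq phi i | i : 'I_n]>>%VS ->
     \sum_(i < n) dotp (phi i) x *: phi i = a *: x) <->
  (forall j, \sum_(i < n) dotp (phi i) (phi j) *: phi i = a *: phi j).
Proof.
split=> [tight j|tight x]; first by apply/tight/memv_span/image_f.
rewrite span_def big_image => /= /memv_sumP[y yP ->].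
have eq_y j : \sum_(i < n) dotp (phi i) (y j) *: phi i = a *: y j.
  have /vlineP[c ->] := yP j isT; rewrite scalerA mulrC -scalerA -tight.
  by rewrite scaler_sumr; apply: eq_bigr => i _; rewrite dotpZ scalerA.
rewrite scaler_sumr -(eq_bigr _ (fun j _ => eq_y j)) exchange_big /=.
apply: eq_bigr => i _; rewrite -scaler_suml; congr (_ *: _).
by rewrite [RHS]exchange_big; apply: eq_bigr => l _; rewrite summxE mulr_sumr.
Qed.

Definition adjmx (m n : nat) (A : 'M[F]_(m, n)) : 'M[F]_(n, m) :=
  map_mx (@sconj R K) A^T.

Lemma gram_mulE (m n : nat) (A : 'M[F]_(m, n)) i j :
  (A *m adjmx A *m A) i j =
  \sum_(i' < m) \sum_(j' < n) A i j' * sconj (A i' j') * A i' j.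
Proof.
rewrite mxE; apply: eq_bigr => i' _; rewrite mxE mulr_suml.
by apply: eq_bigr => j' _; rewrite !mxE.
Qed.

(** Column [j] of [A *m adjmx A *m A] is the frame operator applied to column [j] of [A]. *)
Lemma tight_gramE (m n : nat) (A : 'M[F]_(m, n)) (a : F) :
  (forall x, x \in <<[seq col i A | i : 'I_n]>>%VS ->
     \sum_(i < n) dotp (col i A) x *: col i A = a *: x) <->
  A *m adjmx A *m A = a *: A.
Proof.
have gramE i j :
    (\sum_l dotp (col l A) (col j A) *: col l A) i 0 = (A *m adjmx A *m A) i j.
  rewrite -mulmxA summxE mxE; apply: eq_bigr => l _; rewrite !mxE mulrC.
  by congr (_ * _); apply: eq_bigr => i' _; rewrite !mxE.
rewrite tight_on_span; split=> [tight|tight j].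
  by apply/matrixP=> i j; rewrite -gramE tight !mxE.
by apply/matrixP=> i z; rewrite ord1 gramE tight !mxE.
Qed.

End Scalars.

(** * Matrices whose squared moduli form a BIBD incidence matrix *)

Section PhasedBIBD.
Variables (R : realType) (K : scalars) (k b v : nat).
Local Notation F := (scalar_field R K).
Variables (inc : 'I_b -> 'I_v -> bool) (Phi : 'M[F]_(b, v)) (r : nat).
Hypotheses (incP : linear_space k inc)
  (PhiE : forall i j, `|Phi i j| ^+ 2 = (inc i j)%:R)
  (rE : forall j, #|[set i | inc i j]| = r).

Let Phi_eq0 i j : (Phi i j == 0) = ~~ inc i j.
Proof. by rewrite -normr_eq0 -sqrf_eq0 PhiE; case: inc; rewrite ?oner_eq0 ?eqxx. Qed.

Let Phi_out i j : ~~ inc i j -> Phi i j = 0.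
Proof. by rewrite -Phi_eq0 => /eqP. Qed.

Let norm_Phi i j : inc i j -> `|Phi i j| = 1.
Proof. by move=> ij; apply/eqP; rewrite -sqrp_eq1 // PhiE ij. Qed.

Let sum_inc_col j : \sum_i (inc i j)%:R = r%:R :> F.
Proof.
rewrite -(rE j) -sum1_card natr_sum big_mkcond [RHS]big_mkcond /=.
by apply: eq_bigr => i _; rewrite inE; case: inc.
Qed.

Let sum_inc_row i : \sum_j (inc i j)%:R = k%:R :> F.
Proof.
case: incP => inck _ _; rewrite -(inck i) -sum1_card natr_sum big_mkcond.
by rewrite [RHS]big_mkcond /=; apply: eq_bigr => j _; rewrite inE; case: inc.
Qed.

Lemma dotp_col j : dotp (col j Phi) (col j Phi) = r%:R.
Proof.
by rewrite -(sum_inc_col j); apply: eq_bigr => i _; rewrite !mxE sconj_mul PhiE.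
Qed.

Lemma norm_dotp_col j j' : j != j' -> `|dotp (col j Phi) (col j' Phi)| = 1.
Proof.
case: incP => _ ex_inc inc_uniq jj'.
have [i /andP[ij ij']] := ex_inc _ _ jj'.
rewrite /dotp (bigD1 i) //= big1 ?addr0 => [|i' /eqP neq].
  by rewrite !mxE normrM norm_sconj !norm_Phi // mulr1.
rewrite !mxE; have [i'j|/Phi_out->] := boolP (inc i' j); last by rewrite sconj0 mul0r.
have [i'j'|/Phi_out->] := boolP (inc i' j'); last by rewrite mulr0.
by case: neq; apply: (inc_uniq j j').
Qed.

(* If [inc i j] and [i' <> i], then the only point on both lines is [j]; so the
   row [i' = i] contributes [k], and each of the other [r - 1] lines through
   [j] contributes [1]. *)
Lemma gram_mul_on i j : inc i j ->
  (Phi *m adjmx Phi *m Phi) i j = (r%:R + k%:R - 1) * Phi i j.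
Proof.
case: incP => _ _ inc_uniq ij; rewrite gram_mulE (bigD1 i) //=.
have -> : \sum_j' Phi i j' * sconj (Phi i j') * Phi i j = k%:R * Phi i j.
  rewrite -(sum_inc_row i) mulr_suml; apply: eq_bigr => j' _.
  by rewrite -PhiE -sconj_mul; ring.
have -> : \sum_(i' | i' != i) \sum_j' Phi i j' * sconj (Phi i' j') * Phi i' j =
    (r%:R - 1) * Phi i j.
  rewrite -(sum_inc_col j) [in RHS](bigD1 i) //= ij addrC addrK mulr_suml.
  apply: eq_bigr => i' /eqP neq; rewrite (bigD1 j) //= big1 => [|j' j'j].
    by rewrite -PhiE -sconj_mul addr0; ring.
  have [i'j|/Phi_out->] := boolP (inc i' j); last by rewrite mulr0.
  have [i'j'|/Phi_out->] := boolP (inc i' j'); last by rewrite sconj0 mulr0 mul0r.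
  have [ij'|/Phi_out->] := boolP (inc i j'); last by rewrite !mul0r.
  by case: neq; apply: (inc_uniq j' j).
by ring.
Qed.

Hypotheses (k_gt0 : (0 < k)%N) (r_gt0 : (0 < r)%N).

Let frame_bound_gt0 : 0 < r%:R + k%:R - 1 :> F.
Proof. by rewrite -addrA ltr_wpDr ?ltr0n // subr_ge0 ler1n. Qed.

Lemma phased_ETFP :
  is_ETF (fun j => col j Phi) <->
  Phi *m adjmx Phi *m Phi = (r%:R + k%:R - 1) *: Phi.
Proof.
split=> [[_ _ _ [a _ /tight_gramE tight]]|tight].
  (* No comparison of [a] with [r + k - 1] is made: [gram_mul_on] settles the support, and off it
     both multiples of [Phi i j] vanish. *)
  apply/matrixP=> i j; have [/gram_mul_on->|/Phi_out Phi0] := boolP (inc i j).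
    by rewrite mxE.
  by rewrite tight !mxE Phi0 !mulr0.
split=> [j|j j'||].
- apply: contraTneq r_gt0 => col0.
  rewrite -(ltr0n F) -(dotp_col j) col0 /dotp big1 ?ltxx // => i _.
  by rewrite !mxE mulr0.
- by rewrite /vnorm !dotp_col.
- by exists 1 => j j'; apply: norm_dotp_col.
- by exists (r%:R + k%:R - 1) => //; apply/tight_gramE.
Qed.

Lemma phased_ETF_zeroP :
  is_ETF (fun j => col j Phi) <->
  forall i j, Phi i j = 0 ->
    \sum_(i' < b) \sum_(j' < v) Phi i j' * sconj (Phi i' j') * Phi i' j = 0.
Proof.
rewrite phased_ETFP; split=> [tight i j Phi0|zero].
  by rewrite -gram_mulE tight mxE Phi0 mulr0.
apply/matrixP=> i j; rewrite [RHS]mxE.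
have [/gram_mul_on//|/Phi_out Phi0] := boolP (inc i j).
by rewrite gram_mulE zero // Phi0 mulr0.
Qed.

Lemma rank_phased_ETF :
  is_ETF (fun j => col j Phi) -> (\rank Phi * (r + k - 1) = v * r)%N.
Proof.
move=> /phased_ETFP; set a : F := _ - 1 => tight.
have a_neq0 : a != 0 by rewrite gt_eqF.
(* A projection onto the column space of [Phi]: it fixes [Phi] and has [Phi] as a left factor, so
   the two ranks agree. *)
pose E := a^-1 *: (Phi *m adjmx Phi).
have EPhi : E *m Phi = Phi by rewrite -scalemxAl tight scalerA mulVf ?scale1r.
have EE : E *m E = E by rewrite {2}/E -scalemxAr mulmxA EPhi.
have rankE : \rank E = \rank Phi.
  apply/anti_leq/andP; split; last by rewrite -{1}EPhi mxrankM_maxl.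
  by apply: leq_trans (mxrank_scale _ _) (mxrankM_maxl _ _).
have trE : \tr E = a^-1 * (v * r)%:R.
  (* Cyclicity passes to the Gram matrix, whose [v] diagonal entries are all [r]. *)
  rewrite mxtraceZ mxtrace_mulC; congr (_ * _).
  rewrite /mxtrace (eq_bigr (fun=> r%:R)) => [|j _].
    by rewrite sumr_const card_ord -mulrnA mulnC.
  by rewrite -(dotp_col j) mxE; apply: eq_bigr => i _; rewrite !mxE.
apply/eqP; rewrite -(eqr_nat F) natrM -rankE -(mxrank_idempotent EE) trE.
(* The truncated subtraction is exact because [r > 0]. *)
rewrite natrB ?natrD ?addn_gt0 ?r_gt0 // -/a.
by rewrite mulrAC mulVf ?mul1r.
Qed.

End PhasedBIBD.

(** * Rank, redundancy and the zero-entry criterion *)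

Theorem theorem3p4 (R : realType) (K : scalars) (v k : nat)
    (hk : (2 <= k)%N) (hv : (k < v)%N) :
  let r : rat := (v%:R - 1) / (k%:R - 1) in
  (forall (b : nat) (Phi : 'M[scalar_field R K]_(b, v)),
     is_ETF (fun j => col j Phi) ->
     is_BIBD_incidence_mx k (sqr_modulus Phi) ->
     let d : rat := v%:R * r / (r + k%:R - 1) in
     (\rank Phi)%:R = d /\ v%:R / d < 2) /\
  (forall (b : nat) (Phi : 'M[scalar_field R K]_(b, v)),
     is_BIBD_incidence_mx k (sqr_modulus Phi) ->
     (is_ETF (fun j => col j Phi) <->
      forall i j, Phi i j = 0 ->
        \sum_(i' < b) \sum_(j' < v)
          Phi i j' * sconj (Phi i' j') * Phi i' j = 0)).
Proof.
move=> r.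
have [k_gt0 v_gt0] : (0 < k)%N /\ (0 < v)%N.
  by split; [exact: ltnW | exact: leq_ltn_trans hv].
have k1_gt0 : 0 < k%:R - 1 :> rat by rewrite subr_gt0 ltr1n.
have design b (Phi : 'M[scalar_field R K]_(b, v)) :
    is_BIBD_incidence_mx k (sqr_modulus Phi) ->
    exists (inc : 'I_b -> 'I_v -> bool) (s : nat),
      [/\ linear_space k inc, forall i j, `|Phi i j| ^+ 2 = (inc i j)%:R,
          forall j, #|[set i | inc i j]| = s, (k <= s)%N & r = s%:R].
  move=> /BIBD_incidence_linear_space[inc incP PhiE].
  pose s := #|[set i | inc i (Ordinal v_gt0)]|; exists inc, s.
  have sE : (s * k.-1 = v.-1)%N := replicationE incP _.
  split=> // [i j|j||].
  - by rewrite -PhiE mxE.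
  - apply/eqP; rewrite -(@eqn_pmul2r k.-1) ?sE ?(replicationE incP) //.
    by rewrite -ltnS prednK.
  - exact: leq_line_replication.
  (* The rational quotient [r] is the integer [s], by [sE] cast to [rat]. *)
  - apply: canLR (mulfK (lt0r_neq0 k1_gt0)) _.
    by rewrite -[1 in RHS]/(1%:R) -natrB // subn1 -natrM sE -subn1 natrB.
split=> b Phi.
- move=> ETF /design[inc [s [incP PhiE sP le_ks ->]]] d.
  have s_gt0 : (0 < s)%N := leq_trans k_gt0 le_ks.
  have /(congr1 (fun n => n%:R : rat)) := rank_phased_ETF incP PhiE sP k_gt0 s_gt0 ETF.
  rewrite !natrM natrB ?natrD ?addn_gt0 ?s_gt0 // => rankE.
  have s_gt0' : 0 < s%:R :> rat by rewrite ltr0n.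
  have v_gt0' : 0 < v%:R :> rat by rewrite ltr0n.
  have le_ks' : k%:R <= s%:R :> rat by rewrite ler_nat.
  have a_gt0 : 0 < s%:R + k%:R - 1 :> rat by lra.
  split; first by rewrite /d -rankE mulfK ?lt0r_neq0.
  have -> : v%:R / d = (s%:R + k%:R - 1) / s%:R.
    by rewrite /d; field; rewrite !lt0r_neq0.
  (* From [k <= s] follows [s + k - 1 < 2 * s]. *)
  by rewrite ltr_pdivrMr //; lra.
- move=> /design[inc [s [incP PhiE sP le_ks _]]].
  exact: phased_ETF_zeroP incP PhiE sP k_gt0 (leq_trans k_gt0 le_ks).
Qed.
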